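(* Let $\kappa$ be a finite field, let $n,r$ be positive integers, and for $1\le i\le r$ let $F_i\in\kappa(x_1,\dots,x_n)$ and let $\chi_i:\kappa^\times\to\mathbb{C}^\times$ be a multiplicative character. For $x^{(1)},\dots,x^{(r)}\in\kappa^n$ put \[S(x^{(1)},\dots,x^{(r)}):=\sum_{m\in\kappa^n}\prod_{i=1}^r\chi_i(F_i(m+x^{(i)})).\] Then for every $s\in\mathbb{N}$, \[\sum_{x^{(1)},\dots,x^{(r)}\in\kappa^n}|S(x^{(1)},\dots,x^{(r)})|^{2s}=\sum_{m^{(1)},\dots,m^{(2s)}\in\kappa^n}\ \prod_{i=1}^rT_i(m^{(1)},\dots,m^{(2s)}),\] where \[T_i(m^{(1)},\dots,m^{(2s)}):=\sum_{x\in\kappa^n}\prod_{j=1}^s\chi_i(F_i(m^{(j)}+x))\prod_{j=s+1}^{2s}\chi_i^{-1}(F_i(m^{(j)}+x))=\sum_{x\in\kappa^n}\chi_i(F_{i,\mathbf{m}}(x))\] and $F_{i,\mathbf{m}}(x):=\prod_{j=1}^sF_i(m^{(j)}+x)\prod_{j=s+1}^{2s}F_i(m^{(j)}+x)^{-1}$.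
   Context: Multiplicative characters $\chi$ (including $\chi^{-1}$) are extended to $\kappa$ by $\chi(0)=0$. A rational function $F$ is thought of as a quotient $G/H$ of two fixed polynomials, and $\chi(F(x))$ is stipulated to be $0$ where $G(x)=0$ or $H(x)=0$. In $F_{i,\mathbf{m}}$, the numerator and denominator are the corresponding products of the fixed numerators and denominators of the factors (no cancellation is performed). Convention $0^0=1$. *)

(* Defs.v *)
From HB Require Import structures.
From mathcomp Require Import all_boot all_order all_fingroup all_algebra.
From mathcomp Require Import reals complex.
From mathcomp.multinomials Require Import mpoly.

Set Implicit Arguments.
Unset Strict Implicit.
Unset Printing Implicit Defensive.

Import GRing.Theory.
Local Open Scope ring_scope.

(* Group homomorphisms from K^* to C^*; since {unit K} is a group and C is a
   field, multiplicativity and chi 1 = 1 force the values to be nonzero. *)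
Record mulchar (K : finFieldType) (C : fieldType) := MulChar {
  mulchar_fun :> {unit K} -> C;
  mulchar1 : mulchar_fun 1%g = 1;
  mulcharM : {morph mulchar_fun : u v / (u * v)%g >-> u * v}
}.

Lemma mulchar_neq0 (K : finFieldType) (C : fieldType) (chi : mulchar K C)
  (u : {unit K}) : chi u != 0.
Proof.
apply/eqP => chiu0; move: (mulcharM chi u u^-1%g).
by rewrite mulgV mulchar1 chiu0 mul0r => /eqP; rewrite oner_eq0.
Qed.

Fact mulcharV_subproof1 (K : finFieldType) (C : fieldType)
  (chi : mulchar K C) : (chi 1%g)^-1 = 1.
Proof. by rewrite mulchar1 invr1. Qed.

Fact mulcharV_subproofM (K : finFieldType) (C : fieldType)
  (chi : mulchar K C) :
  {morph (fun u => (chi u)^-1) : u v / (u * v)%g >-> u * v}.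
Proof. by move=> u v; rewrite mulcharM invfM. Qed.

Definition mulcharV (K : finFieldType) (C : fieldType) (chi : mulchar K C) :
    mulchar K C :=
  MulChar (mulcharV_subproof1 chi) (mulcharV_subproofM chi).

Definition mulchar_ext (K : finFieldType) (C : fieldType) (chi : mulchar K C)
    (a : K) : C :=
  if (insub a : option {unit K}) is Some u then chi u else 0.

(* A rational function is a fixed pair \n_F, \d_F of polynomials with
   \d_F != 0, i.e. an element of {ratio {mpoly K[n]}}, rather than its class
   in {fraction {mpoly K[n]}}. *)
Notation ratfun K n := {ratio {mpoly K[n]}}.

Definition chi_at (K : finFieldType) (C : fieldType) (n : nat)
    (chi : mulchar K C) (F : ratfun K n) (x : 'rV[K]_n) : C :=
  let g := (\n_F).@[x 0] in
  let h := (\d_F).@[x 0] in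
  if (g == 0) || (h == 0) then 0 else mulchar_ext chi (g / h).

(* p(a + X) *)
Definition mpoly_translate (K : finFieldType) (n : nat) (a : 'rV[K]_n)
    (p : {mpoly K[n]}) : {mpoly K[n]} :=
  p \mPo [tuple (a 0 i)%:MP + 'X_i | i < n].

Lemma mpoly_translateK (K : finFieldType) (n : nat) (a : 'rV[K]_n) :
  cancel (@mpoly_translate K n a) (mpoly_translate (- a)).
Proof.
move=> p; rewrite /mpoly_translate [X in X \mPo _]comp_mpolyEX raddf_sum [RHS]mpolyE /=.
apply: eq_bigr => m _; rewrite comp_mpolyZ; congr (_ *: _).
rewrite comp_mpolyX rmorph_prod mpolyXE_id /=; apply: eq_bigr => i _.
rewrite rmorphXn /= tnth_mktuple rmorphD /= comp_mpolyC comp_mpolyXU.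
by rewrite -tnth_nth tnth_mktuple mxE rmorphN /= addrA subrr add0r.
Qed.

Fact ratfun_translate_subproof (K : finFieldType) (n : nat) (a : 'rV[K]_n)
  (F : ratfun K n) : mpoly_translate a \d_F != 0.
Proof.
apply/eqP => F0; move: (denom_ratioP F); apply/negP; rewrite negbK.
by rewrite -(mpoly_translateK a \d_F) F0 /mpoly_translate comp_mpoly0.
Qed.

Definition ratfun_translate (K : finFieldType) (n : nat) (a : 'rV[K]_n)
    (F : ratfun K n) : ratfun K n :=
  @mkRatio _ (mpoly_translate a \n_F, mpoly_translate a \d_F)
    (ratfun_translate_subproof a F).

Definition ratfun1 (K : finFieldType) (n : nat) : ratfun K n := Ratio 1 1.

(* FracField.mulf and FracField.invf work on the pairs themselves, without
   cancellation: G/H * G'/H' = GG'/HH' and (G/H)^-1 = H/G.  The inverse of 0/H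
   is 0/1, on which chi_at vanishes everywhere, as it does on 0/H. *)
Definition Fm (K : finFieldType) (n s : nat) (F : ratfun K n)
    (m : {ffun 'I_(2 * s) -> 'rV[K]_n}) : ratfun K n :=
  FracField.mulf
    (\big[@FracField.mulf _/ratfun1 K n]_(j < 2 * s | (j < s)%N)
       ratfun_translate (m j) F)
    (\big[@FracField.mulf _/ratfun1 K n]_(j < 2 * s | (s <= j)%N)
       FracField.invf (ratfun_translate (m j) F)).

Definition Ssum (K : finFieldType) (C : fieldType) (n r : nat)
    (F : 'I_r -> ratfun K n) (chi : 'I_r -> mulchar K C)
    (x : {ffun 'I_r -> 'rV[K]_n}) : C :=
  \sum_(m : 'rV[K]_n) \prod_(i < r) chi_at (chi i) (F i) (m + x i).

Definition Tsum (K : finFieldType) (C : fieldType) (n s : nat)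
    (F : ratfun K n) (chi : mulchar K C)
    (m : {ffun 'I_(2 * s) -> 'rV[K]_n}) : C :=
  \sum_(x : 'rV[K]_n)
    (\prod_(j < 2 * s | (j < s)%N) chi_at chi F (m j + x)) *
    (\prod_(j < 2 * s | (s <= j)%N) chi_at (mulcharV chi) F (m j + x)).

(* Main.v *)
Require Import Defs.
From HB Require Import structures.
From mathcomp Require Import all_boot all_order all_fingroup all_algebra.
From mathcomp Require Import reals complex.
From mathcomp.multinomials Require Import mpoly.

Set Implicit Arguments.
Unset Strict Implicit.
Unset Printing Implicit Defensive.

Import GRing.Theory Num.Theory.
Local Open Scope ring_scope.
Local Open Scope complex_scope.

(** Since a character of a finite group has values of norm [1], its complex
conjugate is its inverse.  So expanding [|S|^(2s) = S^s * conj(S)^s] gives a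
sum over [(m_j)_j] of products over [i] and [j] of factors that depend on
[x_i] and [m_j] only; summing over [x] first, the sum factors over [i]. *)

Section MulcharExt.
Variables (K : finFieldType) (C : fieldType).
Implicit Types (chi : mulchar K C) (a b : K).

Lemma mulchar_ext_unit chi (u : {unit K}) : mulchar_ext chi (val u) = chi u.
Proof. by rewrite /mulchar_ext valK. Qed.

Lemma mulchar_ext0 chi : mulchar_ext chi 0 = 0.
Proof. by rewrite /mulchar_ext insubF // unitr0. Qed.

Lemma mulchar_ext1 chi : mulchar_ext chi 1 = 1.
Proof. by rewrite -[1]/(val (1%g : {unit K})) mulchar_ext_unit mulchar1. Qed.

Lemma mulchar_extM chi : {morph mulchar_ext chi : a b / a * b}.
Proof.
move=> a b; have [->|a0] := eqVneq a 0; first by rewrite !(mul0r, mulchar_ext0).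
have [->|b0] := eqVneq b 0; first by rewrite !(mulr0, mulchar_ext0).
have [ua ub] : a \is a GRing.unit /\ b \is a GRing.unit by rewrite !unitfE.
rewrite -[a]/(val (Sub a ua : {unit K})) -[b]/(val (Sub b ub : {unit K})).
by rewrite -FinRing.val_unitM !mulchar_ext_unit mulcharM.
Qed.

Lemma mulchar_extV chi a : mulchar_ext (mulcharV chi) a = (mulchar_ext chi a)^-1.
Proof. by rewrite /mulchar_ext; case: insubP => //=; rewrite invr0. Qed.

(** No hypothesis on [a] is needed: both fields set [0^-1 = 0], and the extension sends [0] to
    [0]. *)
Lemma mulchar_ext_inv chi a : mulchar_ext chi a^-1 = (mulchar_ext chi a)^-1.
Proof.
have [->|a0] := eqVneq a 0; first by rewrite !(invr0, mulchar_ext0).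
by apply/esym/divr1_eq; rewrite -invfM -mulchar_extM mulfV // mulchar_ext1 invr1.
Qed.

End MulcharExt.

(** For nonzero [a], with [k] its order in the unit group, the value at [a] is a [k]-th root of
    unity; its norm is a nonnegative number with [k]-th power [1], hence is [1], and conjugation is
    inversion. At [a = 0] both sides vanish. *)
Lemma conjC_mulchar_ext (K : finFieldType) (C : numClosedFieldType)
  (chi : mulchar K C) (a : K) :
  (mulchar_ext chi a)^*%R = mulchar_ext (mulcharV chi) a.
Proof.
rewrite mulchar_extV; have [->|a0] := eqVneq a 0.
  by rewrite mulchar_ext0 conjC0 invr0.
suff n1 : `|mulchar_ext chi a| = 1 by rewrite invC_norm n1 expr1n invr1 mul1r.
have chiX k : mulchar_ext chi (a ^+ k) = mulchar_ext chi a ^+ k.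
  by elim: k => [|k IHk]; rewrite ?mulchar_ext1 // !exprS mulchar_extM IHk.
have ua : a \is a GRing.unit by rewrite unitfE.
pose u : {unit K} := Sub a ua.
have aX : a ^+ #[u]%g = 1 by rewrite -[a]/(val u) -FinRing.val_unitX expg_order.
apply/eqP; rewrite -(@pexpr_eq1 _ _ #[u]%g) ?order_gt0 //.
by rewrite -normrX -chiX aX mulchar_ext1 normr1.
Qed.

Section ChiAt.
Variables (K : finFieldType) (C : fieldType) (n : nat).
Implicit Types (chi : mulchar K C) (F G : ratfun K n) (x : 'rV[K]_n).

(** The case distinction in [chi_at] is absorbed by the conventions at [0]: a zero of either
    polynomial makes the quotient [0], where the extended character vanishes. The identities below
    thus need no separate treatment of zeros and poles. *)
Lemma chi_atE chi F x :
  chi_at chi F x = mulchar_ext chi ((\n_F).@[x 0] / (\d_F).@[x 0]).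
Proof.
rewrite /chi_at; case: eqP => [->|_] /=; first by rewrite mul0r mulchar_ext0.
by case: eqP => [->|_]; rewrite // invr0 mulr0 mulchar_ext0.
Qed.

Lemma chi_at_translate chi a F x :
  chi_at chi (ratfun_translate a F) x = chi_at chi F (a + x).
Proof.
have evE (p : {mpoly K[n]}) : (mpoly_translate a p).@[x 0] = p.@[(a + x) 0].
  rewrite comp_mpoly_meval; apply: meval_eq => i.
  by rewrite tnth_mktuple mevalD mevalC mevalXU mxE.
by rewrite !chi_atE /= !evE.
Qed.

Lemma chi_at1 chi x : chi_at chi (ratfun1 K n) x = 1.
Proof.
by rewrite chi_atE /ratfun1 !numden_Ratio ?oner_neq0 // meval1 divr1 mulchar_ext1.
Qed.

Lemma chi_atM chi F G x :
  chi_at chi (FracField.mulf F G) x = chi_at chi F x * chi_at chi G x.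
Proof.
rewrite !chi_atE /FracField.mulf !numden_Ratio ?mulf_neq0 ?denom_ratioP //.
by rewrite !mevalM invfM mulrACA mulchar_extM.
Qed.

Lemma chi_at_inv chi F x :
  chi_at chi (FracField.invf F) x = chi_at (mulcharV chi) F x.
Proof.
rewrite !chi_atE mulchar_extV -mulchar_ext_inv invf_div /FracField.invf.
(* If the numerator of [F] is the zero polynomial, [invf] returns the default [0/1], and both sides
   are the character at [0]. *)
by case: RatioP => [_|//]; rewrite /= !meval0 mul0r invr0 mulr0.
Qed.

Lemma chi_at_prod chi x (I : finType) (P : pred I) (G : I -> ratfun K n) :
  chi_at chi (\big[@FracField.mulf _/ratfun1 K n]_(j | P j) G j) x
    = \prod_(j | P j) chi_at chi (G j) x.
Proof.
exact: (big_morph (chi_at chi ^~ x) (fun F G => chi_atM chi F G x) (chi_at1 chi x)).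
Qed.

Lemma Tsum_Fm (s : nat) F chi (m : {ffun 'I_(2 * s) -> 'rV[K]_n}) :
  Tsum F chi m = \sum_x chi_at chi (Fm F m) x.
Proof.
apply: eq_bigr => x _; rewrite chi_atM !chi_at_prod; congr (_ * _).
  by apply: eq_bigr => j _; rewrite chi_at_translate.
by apply: eq_bigr => j _; rewrite chi_at_inv chi_at_translate.
Qed.

End ChiAt.

(** With [z] the sum [S] and [w] its conjugate, this writes the [2s]-th power of the norm as one
    product over [2 * s] indices. *)
Lemma prod_ltn_const (C : comPzSemiRingType) (s : nat) (z w : C) :
  \prod_(j < 2 * s) (if (j < s)%N then z else w) = (z * w) ^+ s.
Proof.
rewrite mul2n -addnn big_split_ord exprMn /=; congr (_ * _).
  rewrite -[in RHS](card_ord s) -prodr_const.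
  by apply: eq_bigr => j _; rewrite ltn_ord.
rewrite -[in RHS](card_ord s) -prodr_const.
by apply: eq_bigr => j _; rewrite ltnNge leq_addr.
Qed.

Section Moment.
Variables (K : finFieldType) (C : numClosedFieldType) (n r : nat).
Variables (F : 'I_r -> ratfun K n) (chi : 'I_r -> mulchar K C).

Lemma conjC_Ssum x : (Ssum F chi x)^*%R = Ssum F (fun i => mulcharV (chi i)) x.
Proof.
rewrite /Ssum rmorph_sum; apply: eq_bigr => m _; rewrite rmorph_prod.
by apply: eq_bigr => i _; rewrite /= !chi_atE conjC_mulchar_ext.
Qed.

Lemma moment_Ssum (s : nat) :
  \sum_x `|Ssum F chi x| ^+ (2 * s)
    = \sum_(m : {ffun 'I_(2 * s) -> 'rV[K]_n}) \prod_(i < r) Tsum (F i) (chi i) m.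
Proof.
(* [c j] lists the characters in the [j]-th factor: the first [s] factors are [S], the others its
   conjugate. *)
pose c (j : 'I_(2 * s)) i := if (j < s)%N then chi i else mulcharV (chi i).
transitivity (\sum_(x : {ffun 'I_r -> 'rV[K]_n})
    \sum_(m : {ffun 'I_(2 * s) -> 'rV[K]_n})
      \prod_(i < r) \prod_(j < 2 * s) chi_at (c j i) (F i) (m j + x i)).
  apply: eq_bigr => x _; rewrite exprM normCK conjC_Ssum -prod_ltn_const.
  transitivity (\prod_(j < 2 * s) Ssum F (c j) x).
    by apply: eq_bigr => j _; rewrite /c; case: ifP.
  rewrite bigA_distr_bigA; apply: eq_bigr => m _.
  by rewrite exchange_big.
rewrite exchange_big; apply: eq_bigr => m _ /=.
(* For fixed [m], the [i]-th factor depends on [x] only through [x i], so distributivity read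
   backwards turns the sum over all [x] into a product over [i] of sums over one vector. *)
rewrite -(bigA_distr_bigA (fun i x =>
  \prod_(j < 2 * s) chi_at (c j i) (F i) (m j + x))).
apply: eq_bigr => i _; apply: eq_bigr => x _.
rewrite (bigID (fun j : 'I__ => (j < s)%N)) /=; congr (_ * _).
  by apply: eq_bigr => j js; rewrite /c js.
by apply: eq_big => j; rewrite -leqNgt // /c leqNgt; case: ifP.
Qed.

End Moment.

Theorem proposition1p2 (R : realType) (K : finFieldType) (n r : nat)
  (n_gt0 : (0 < n)%N) (r_gt0 : (0 < r)%N)
  (F : 'I_r -> ratfun K n) (chi : 'I_r -> mulchar K R[i]) (s : nat) :
  \sum_(x : {ffun 'I_r -> 'rV[K]_n}) `|Ssum F chi x| ^+ (2 * s)
    = \sum_(m : {ffun 'I_(2 * s) -> 'rV[K]_n})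
        \prod_(i < r) Tsum (F i) (chi i) m
  /\ forall (i : 'I_r) (m : {ffun 'I_(2 * s) -> 'rV[K]_n}),
       Tsum (F i) (chi i) m
         = \sum_(x : 'rV[K]_n) chi_at (chi i) (Fm (F i) m) x.
Proof.
split=> [|i m]; first exact: moment_Ssum.
exact: Tsum_Fm.
Qed.
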